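(* Let $k$ be a positive integer, $\tau>0$, and let $u_i^0\in H_0^1(\Omega)$, $i\in[k]$, be the initial data. For $n\ge0$ let $u_i^{n+1}$, $i\in[k]$, be computed from $u_i^n$, $i\in[k]$, by the following four-step operator splitting algorithm: (1) (diffusion step) $\tilde u_i^{n+1}=e^{\tau\Delta}u_i^n$; (2) (positivity-preserving step) $\bar u_i^{n+1}=\max\{\tilde u_i^{n+1},0\}$; (3) (orthogonality-preserving step) pointwise in $\Omega$, $$\hat u_i^{n+1}=\begin{cases}\dfrac{(\bar u_i^{n+1})^2-\max_{j\in[k],j\ne i}\{(\bar u_j^{n+1})^2\}}{\bar u_i^{n+1}},&\text{if }\bar u_i^{n+1}>\max_{j\in[k],j\ne i}\{\bar u_j^{n+1}\},\\[0.5em]0,&\text{otherwise};\end{cases}$$ (4) (norm-preserving step) $u_i^{n+1}=\hat u_i^{n+1}/\|\hat u_i^{n+1}\|$. Then $$u_i^{n+1}\ge0,\qquad \|u_i^{n+1}\|=1,\qquad u_i^{n+1}u_j^{n+1}=0,\qquad i\in[k],\ \forall j\in[k],\ j\ne i.$$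
   Context: $\Omega\subset\mathbb{R}^d$ is a given bounded smooth domain, $[k]=\{1,\dots,k\}$, and $\|\cdot\|$ is the $L^2(\Omega)$ norm. $e^{\tau\Delta}$ is the solution operator at time $\tau$ of the heat equation $\partial_tv=\Delta v$ on $\Omega$ with the chosen (periodic, Dirichlet or Neumann) boundary conditions. Identities and inequalities between functions are pointwise in $\Omega$.
   Formalization: It is additionally assumed that every norm ‖û_i^{m+1}‖ with m ≤ n is nonzero, so that the divisions in step (4) are defined; this fails, for example, for k=2 with identical initial data, where û_i^1=0 and ‖u_i^1‖=1 is impossible. *)

(* Defs.v *)
From HB Require Import structures.
From mathcomp Require Import all_boot all_order all_algebra.
From mathcomp Require Import all_classical all_reals all_analysis.

Set Implicit Arguments.
Unset Strict Implicit.
Unset Printing Implicit Defensive.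

Import Order.TTheory GRing.Theory Num.Theory.
Import numFieldNormedType.Exports.

Local Open Scope classical_set_scope.
Local Open Scope ring_scope.

(** * Lebesgue measure on R^d *)

Definition rV_display : measure_display -> measure_display.
Proof. exact. Qed.

(* 'rV[R]_d carries the sigma-algebra generated by its coordinates, as tuples do
   in the library; 'rV[R]_d being second countable, it is the Borel one. *)
Section rV_measurable.
Context {R : realType} {d : nat}.

Definition rV_coord (i : 'I_d) (x : 'rV[R]_d) : R := x ord0 i.

Let rV_set0 : g_sigma_preimage rV_coord set0.
Proof. exact: sigma_algebra0. Qed.

Let rV_setC A : g_sigma_preimage rV_coord A -> g_sigma_preimage rV_coord (~` A).
Proof. exact: sigma_algebraC. Qed.

Let rV_bigcup (F : _^nat) : (forall i, g_sigma_preimage rV_coord (F i)) ->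
  g_sigma_preimage rV_coord (\bigcup_i (F i)).
Proof. exact: sigma_algebra_bigcup. Qed.

HB.instance Definition _ :=
  @isMeasurable.Build (rV_display default_measure_display)
    'rV[R]_d (g_sigma_preimage rV_coord) rV_set0 rV_setC rV_bigcup.

Lemma measurable_rV_coord (i : 'I_d) : measurable_fun setT (rV_coord i).
Proof.
move=> _ Y mY; rewrite setTI; apply: sub_sigma_algebra => /=.
rewrite -bigcup_seq/=; exists i => /=; first by rewrite mem_index_enum.
by exists Y => //; rewrite setTI.
Qed.

Lemma measurable_fun_rVP d1 (T1 : measurableType d1) (f : T1 -> 'rV[R]_d) :
  measurable_fun setT f <->
  forall i, measurable_fun setT (rV_coord i \o f).
Proof.
split=> [mf i|mf].
  exact: measurableT_comp (measurable_rV_coord i) mf.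
have sub : g_sigma_preimage (fun i => rV_coord i \o f) `<=` measurable.
  apply: smallest_sub; first exact: sigma_algebra_measurable.
  rewrite -bigcup_seq; apply: bigcup_sub => i _.
  by move=> A [B mB <-]; exact: mf.
rewrite g_sigma_preimage_comp in sub.
by move=> _ A mA; apply: sub; exists A.
Qed.

End rV_measurable.

Section lebesgue_rV.
Context {R : realType}.

Definition rV_cons n (p : R * 'rV[R]_n) : 'rV[R]_n.+1 :=
  \row_i if unlift ord0 i is Some j then p.2 ord0 j else p.1.

Definition rV_uncons n (x : 'rV[R]_n.+1) : R * 'rV[R]_n :=
  (x ord0 ord0, \row_j x ord0 (lift ord0 j)).

Lemma rV_consK n : cancel (@rV_cons n) (@rV_uncons n).
Proof.
case=> x v; rewrite /rV_uncons /rV_cons mxE unlift_none; congr pair.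
by apply/rowP => j; rewrite !mxE liftK.
Qed.

Lemma measurable_rV_cons n : measurable_fun setT (@rV_cons n).
Proof.
apply/measurable_fun_rVP => i; case: (unliftP ord0 i) => [j|] ->.
  rewrite (_ : _ \o _ = @rV_coord R n j \o snd).
    exact: measurableT_comp (measurable_rV_coord j) measurable_snd.
  by apply/funext => p; rewrite /rV_coord/= mxE liftK.
rewrite (_ : _ \o _ = fst); first exact: measurable_fst.
by apply/funext => p; rewrite /rV_coord/= mxE unlift_none.
Qed.

Lemma measurable_rV_uncons n : measurable_fun setT (@rV_uncons n).
Proof.
apply: measurable_fun_pair; first exact: measurable_rV_coord.
apply/measurable_fun_rVP => i.
rewrite (_ : _ \o _ = @rV_coord R n.+1 (lift ord0 i)).
  exact: measurable_rV_coord.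
by apply/funext => x; rewrite /rV_coord/= mxE.
Qed.

Section cons_measure.
Variables (n : nat) (l : {sigma_finite_measure set (measurableTypeR R) -> \bar R}).
Variable m : {sigma_finite_measure set 'rV[R]_n -> \bar R}.

Definition cons_measure : set 'rV[R]_n.+1 -> \bar R :=
  pushforward (l \x m)%E (@rV_cons n).

Let cons_measure0 : cons_measure set0 = 0%E.
Proof. by rewrite /cons_measure /pushforward preimage_set0 measure0. Qed.

Let cons_measure_ge0 A : (0 <= cons_measure A)%E.
Proof. by rewrite /cons_measure /pushforward; exact: measure_ge0. Qed.

Let cons_measure_sigma_additive : semi_sigma_additive cons_measure.
Proof.
move=> F mF tF mUF; rewrite /cons_measure /pushforward preimage_bigcup.
apply: measure_semi_sigma_additive.
- by move=> i; rewrite -[X in measurable X]setTI; exact: measurable_rV_cons.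
- apply/trivIsetP => /= i j _ _ ij; rewrite -preimage_setI.
  by move/trivIsetP : tF => /(_ _ _ _ _ ij) ->//; rewrite preimage_set0.
- rewrite -preimage_bigcup -[X in measurable X]setTI.
  exact: measurable_rV_cons.
Qed.

HB.instance Definition _ := isMeasure.Build _ _ _ cons_measure
  cons_measure0 cons_measure_ge0 cons_measure_sigma_additive.

Let cons_measure_sigma_finite : sigma_finite setT cons_measure.
Proof.
have /sigma_finiteP[F [FT ndF Foo]] := sigma_finiteT l.
have /sigma_finiteP[G [GT ndG Goo]] := sigma_finiteT m.
exists (fun k => @rV_uncons n @^-1` (F k `*` G k)).
  rewrite -preimage_bigcup -[LHS](preimage_setT (@rV_uncons n)).
  congr (_ @^-1` _); apply/esym/seteqP; split=> // -[x v] _.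
  have [i _ Fx] : (\bigcup_i F i) x by rewrite -FT.
  have [j _ Gv] : (\bigcup_j G j) v by rewrite -GT.
  exists (maxn i j) => //; split.
    by apply: (subsetPset _ _ (ndF _ _ (leq_maxl i j))).
  by apply: (subsetPset _ _ (ndG _ _ (leq_maxr i j))).
move=> k; have [mF Fk] := Foo k; have [mG Gk] := Goo k; split.
  rewrite -[X in measurable X]setTI; apply: measurable_rV_uncons => //.
  exact: measurableX.
rewrite /cons_measure /pushforward (_ : _ @^-1` _ = F k `*` G k); last first.
  by apply/funext => p; exact: (congr1 (F k `*` G k) (rV_consK p)).
by rewrite product_measure1E// lte_mul_pinfty// ge0_fin_numE.
Qed.

HB.instance Definition _ := Measure_isSigmaFinite.Build _ _ _ cons_measure
  cons_measure_sigma_finite.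

End cons_measure.

Fixpoint lebesgue_rV d : {sigma_finite_measure set 'rV[R]_d -> \bar R} :=
  match d with
  | 0 => @dirac _ _ (0 : 'rV[R]_0) R
  | d'.+1 => cons_measure lebesgue_measure (lebesgue_rV d')
  end.

End lebesgue_rV.

(** * Function spaces on a domain of R^d

   A function on W is represented by a total function on R^d whose values
   outside W are irrelevant; [f \_ W] is its extension by zero. *)

Section function_spaces.
Context {R : realType} {d : nat}.
Implicit Types (W : set 'rV[R]_d) (u f : 'rV[R]_d -> R).
Implicit Types (g : 'I_d -> 'rV[R]_d -> R).

Definition L2norm W f : \bar R := 'N[lebesgue_rV d]_2%:E[EFin \o (f \_ W)]%E.

Definition L2 W : set ('rV[R]_d -> R) :=
  [set f | f \_ W \in Lfun (lebesgue_rV d) 2%:E].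

Definition pderiv (i : 'I_d) f : 'rV[R]_d -> R := 'D_(delta_mx ord0 i) f.

Definition smooth f : Prop :=
  forall (s : seq 'I_d) (x : 'rV[R]_d), differentiable (foldr pderiv f s) x.

Definition test_function W : set ('rV[R]_d -> R) :=
  [set phi | smooth phi /\
     exists K, [/\ compact K, K `<=` W & forall x, ~ K x -> phi x = 0]].

Definition weak_gradient W u g : Prop :=
  [/\ L2 W u, forall i, L2 W (g i) &
     forall i phi, test_function W phi ->
       \int[lebesgue_rV d]_(x in W) (u x * pderiv i phi x) =
       - \int[lebesgue_rV d]_(x in W) (g i x * phi x)].

Definition H1 W : set ('rV[R]_d -> R) :=
  [set u | exists g, weak_gradient W u g].

Definition H1_closure W (S : set ('rV[R]_d -> R)) : set ('rV[R]_d -> R) :=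
  [set u | exists g, weak_gradient W u g /\
     exists phi : nat -> 'rV[R]_d -> R,
       [/\ forall n, S (phi n),
           L2norm W (phi n \- u) @[n --> \oo] --> 0%E &
           forall i, L2norm W (pderiv i (phi n) \- g i) @[n --> \oo] --> 0%E]].

Definition H10 W := H1_closure W (test_function W).

(* L i is the period in the i-th coordinate direction. *)
Definition H1_periodic W (L : 'rV[R]_d) :=
  H1_closure W [set phi | smooth phi /\
    forall i x, phi (x + L ord0 i *: delta_mx ord0 i) = phi x].

End function_spaces.

(** * The heat equation *)

Section heat.
Context {R : realType} {d : nat}.
Implicit Types (W : set 'rV[R]_d) (u f v : 'rV[R]_d -> R).

Inductive boundary_condition :=
  | Dirichlet
  | Neumann
  | Periodic of 'rV[R]_d & 'rV[R]_d.

(* Near each boundary point, W is the sublevel set {rho < 0} of a smooth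
   function with nonvanishing gradient. *)
Definition smooth_bounded_domain W : Prop :=
  [/\ open W, W !=set0, connected W, bounded_set W &
     forall x, (closure W `\` W) x ->
       exists rho, [/\ smooth rho,
         exists i, pderiv i rho x != 0 &
         \forall y \near x, W y <-> rho y < 0]].

(* Periodic conditions identify opposite faces, so they are meaningful on a box
   a < x < b, i.e. on a fundamental domain of the flat torus. *)
Definition admissible_domain (bc : boundary_condition) W : Prop :=
  match bc with
  | Periodic a b => (forall i, a ord0 i < b ord0 i) /\
      W = [set x | forall i, a ord0 i < x ord0 i < b ord0 i]
  | _ => smooth_bounded_domain W
  end.

Definition form_domain (bc : boundary_condition) W : set ('rV[R]_d -> R) :=
  match bc with
  | Dirichlet => H10 W
  | Neumann => H1 W
  | Periodic a b => H1_periodic W (b - a)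
  end.

(* The L^2 realization of the Laplacian under the boundary condition: v is in
   its domain and its image is f. Green's identity against the whole of the form
   domain encodes the Neumann (resp. periodic) condition as a natural one. *)
Definition laplacian (bc : boundary_condition) W v f : Prop :=
  [/\ form_domain bc W v, L2 W f &
     exists gv, weak_gradient W v gv /\
       forall phi gphi, form_domain bc W phi -> weak_gradient W phi gphi ->
         \sum_(i < d) \int[lebesgue_rV d]_(x in W) (gv i x * gphi i x) =
         - \int[lebesgue_rV d]_(x in W) (f x * phi x)].

(* v = e^{t Laplacian} u: v is the value at time t of the solution w : [0,oo) ->
   L^2(W) of w' = Laplacian w on (0,oo) (strong L^2 derivative), continuous at 0
   with w(0) = u. This determines v up to a null set; any representative is
   accepted. *)
Definition heat_operator (bc : boundary_condition) W (t : R) u v : Prop :=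
  exists w : R -> 'rV[R]_d -> R,
    [/\ forall s, 0 <= s -> L2 W (w s),
        {in W, w 0 =1 u} /\ {in W, w t =1 v},
        L2norm W (w s \- w 0) @[s --> 0^'+] --> 0%E &
        forall s, 0 < s -> exists2 f, laplacian bc W (w s) f &
          L2norm W (fun x => h^-1 * (w (s + h) x - w s x) - f x)
            @[h --> 0^'] --> 0%E].

End heat.
Arguments boundary_condition : clear implicits.

(** * The splitting algorithm *)

Section splitting.
Context {R : realType} {k : nat} {T : Type}.

(* Maximum of a nonnegative family over the indices other than i; it is 0 when
   there is no other index. *)
Definition max_other (a : 'I_k -> R) (i : 'I_k) : R :=
  \big[Num.max/0]_(j < k | j != i) a j.

Definition orthogonality_step (ub : 'I_k -> T -> R) (i : 'I_k) (x : T) : R :=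
  if ub i x > max_other (ub ^~ x) i
  then (ub i x ^+ 2 - max_other (fun j => ub j x ^+ 2) i) / ub i x
  else 0.

End splitting.

(* Main.v *)
(** Nonnegativity and the disjointness of supports are pointwise facts
    about the orthogonality step.  For the normalization it remains to see that
    the norm being divided by is finite: the heat semigroup takes values in
    L^2(Omega), and 0 <= uh <= ub <= |ut| pointwise.  Measurability of uh is
    needed too, as otherwise the norm need not be homogeneous. *)

Require Import Defs.
From mathcomp Require Import all_boot all_order all_algebra.
From mathcomp Require Import all_classical all_reals all_analysis.
From mathcomp Require Import measurable_realfun.

Import Order.TTheory GRing.Theory Num.Theory.
Import numFieldNormedType.Exports.

Local Open Scope classical_set_scope.
Local Open Scope ring_scope.

Section max_other.
Context {R : realType} {k : nat}.
Implicit Types (a : 'I_k -> R) (i j : 'I_k).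

Lemma max_other_ge0 a i : 0 <= max_other a i.
Proof. exact: bigmax_ge_id. Qed.

Lemma le_max_other a i j : j != i -> a j <= max_other a i.
Proof. by move=> ji; exact: (le_bigmax_cond _ a). Qed.

(** Squaring is monotone on nonnegative reals, and the default value 0 of the maximum is below any
    square. With [y := a i] this makes the numerator of the orthogonality step nonnegative. *)
Lemma max_other_sqr_le a i y : (forall j, 0 <= a j) -> max_other a i <= y ->
  max_other (fun j => a j ^+ 2) i <= y ^+ 2.
Proof.
move=> a0 ay; apply/bigmax_leP; split=> [|j ji]; first exact: sqr_ge0.
have aj_le_y : a j <= y := le_trans (le_max_other a i j ji) ay.
by rewrite ler_pXn2r ?nnegrE// (le_trans (a0 j)).
Qed.

End max_other.

Section orthogonality_step.
Context {R : realType} {k : nat} {T : Type}.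
Implicit Types (a : 'I_k -> T -> R) (i j : 'I_k) (x : T).

(** The step acts pointwise, so a family prescribed only on [W] can be traded there for one
    controlled everywhere. *)
Lemma eq_orthogonality_step a b i x : (forall j, a j x = b j x) ->
  orthogonality_step a i x = orthogonality_step b i x.
Proof.
move=> ab; rewrite /orthogonality_step /max_other ab.
by under eq_bigr do rewrite ab; under [in X in _ - X]eq_bigr do rewrite ab.
Qed.

Lemma orthogonality_step_ge0 a i x : (forall j, 0 <= a j x) ->
  0 <= orthogonality_step a i x.
Proof.
move=> a0; rewrite /orthogonality_step; case: ifPn => // /ltW ai.
by rewrite divr_ge0// subr_ge0 max_other_sqr_le.
Qed.

Lemma orthogonality_step_le a i x : 0 <= a i x ->
  orthogonality_step a i x <= a i x.
Proof.
move=> a0; rewrite /orthogonality_step; case: ifPn => // ai.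
(* The maximum starts from 0, so exceeding it strictly makes the denominator positive. *)
have a_gt0 : 0 < a i x by rewrite (le_lt_trans _ ai)// max_other_ge0.
by rewrite ler_pdivrMr// -expr2 lerBlDr lerDl max_other_ge0.
Qed.

(** If both factors were in the first branch, each of [a i x] and [a j x] would strictly exceed the
    other. *)
Lemma orthogonality_step_mul0 a i j x : j != i ->
  orthogonality_step a i x * orthogonality_step a j x = 0.
Proof.
move=> ji; rewrite /orthogonality_step.
case: ifPn => [ai|]; last by rewrite mul0r.
case: ifPn => [aj|]; last by rewrite mulr0.
have := le_lt_trans (le_max_other (a ^~ x) i j ji) ai.
have ij : i != j by rewrite eq_sym.
by rewrite ltNge (ltW (le_lt_trans (le_max_other (a ^~ x) j i ij) aj)).
Qed.

End orthogonality_step.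

Section measurability.
Context {R : realType} {k : nat} d (T : measurableType d).
Implicit Types (a : 'I_k -> T -> R) (i : 'I_k).

Lemma measurable_max_other a i : (forall j, measurable_fun setT (a j)) ->
  measurable_fun setT (fun x => max_other (a ^~ x) i).
Proof.
move=> ma; rewrite /max_other; elim: (index_enum _) => [|j s ih].
  by under eq_fun do rewrite big_nil; exact: measurable_cst.
under eq_fun do rewrite big_cons.
by case: (j != i) => //; exact: measurable_maxr.
Qed.

(** Nonnegativity lets the inverse be written as the real power of exponent -1; at 0 both are 0. *)
Lemma measurable_orthogonality_step a i : (forall j x, 0 <= a j x) ->
  (forall j, measurable_fun setT (a j)) ->
  measurable_fun setT (orthogonality_step a i).
Proof.
move=> a0 ma; apply: measurable_fun_ifT => //.
  by apply: measurable_fun_ltr => //; exact: measurable_max_other.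
apply: measurable_funM.
  apply: measurable_funB; first exact: measurable_funX.
  apply: (measurable_max_other (fun j x => a j x ^+ 2)) => j.
  exact: measurable_funX.
(* the library has the measurability of real powers, not of inverses *)
under eq_fun do rewrite -powR_inv1//.
exact: measurableT_comp (measurable_powR (-1)) (ma i).
Qed.

End measurability.

Section Lfun.
Context d (T : measurableType d) {R : realType}.
Variable mu : {measure set T -> \bar R}.
Implicit Types f g : T -> R.

Lemma le_Lnorm r f g : 0 <= r ->
  measurable_fun setT f -> measurable_fun setT g ->
  (forall x, `|f x| <= `|g x|) ->
  ('N[mu]_r%:E[EFin \o f] <= 'N[mu]_r%:E[EFin \o g])%E.
Proof.
move=> r0 mf mg fg; rewrite unlock /Lnorm.
have mpow (h : T -> R) : measurable_fun setT h ->
    measurable_fun setT (fun x => `|(EFin \o h) x| `^ r)%E.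
  move=> mh; rewrite (_ : (fun _ => _) = EFin \o (fun x => `|h x| `^ r))//.
  apply/measurable_EFinP; apply: (measurableT_comp (measurable_powR r)).
  exact: measurableT_comp.
rewrite gt0_ler_poweR//=; first by rewrite invr_ge0.
- by rewrite in_itv/= leey integral_ge0// => x _; exact: poweR_ge0.
- by rewrite in_itv/= leey integral_ge0// => x _; exact: poweR_ge0.
apply: ge0_le_integral => //=.
- exact: mpow f mf.
- exact: mpow g mg.
- by move=> x _; rewrite lee_fin ge0_ler_powR// nnegrE.
Qed.

Lemma Lfun_le r f g : 0 <= r -> g \in Lfun mu r%:E ->
  measurable_fun setT f -> (forall x, `|f x| <= `|g x|) ->
  f \in Lfun mu r%:E.
Proof.
move=> r0 /[!inE] /andP[/[!inE]/= mg gfin] mf fg.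
apply/andP; split; rewrite inE//=.
exact: le_lt_trans (le_Lnorm r f g r0 mf mg fg) gfin.
Qed.

(** Homogeneity of the norm, plus cancellation: membership in [Lfun] makes the norm finite, so
    [fine] loses nothing, and a nonzero norm is then invertible. *)
Lemma Lnorm_normalize p f : (1 <= p)%E -> f \in Lfun mu p ->
  'N[mu]_p[EFin \o f]%E <> 0%E ->
  'N[mu]_p[EFin \o ((fine 'N[mu]_p[EFin \o f]%E)^-1 \*: f)]%E = 1%E.
Proof.
move=> p1 fp f0; rewrite (LnormZ (Lfun_Sub p1 fp)) /=.
have : 'N[mu]_p[EFin \o f]%E \is a fin_num.
  rewrite ge0_fin_numE ?Lnorm_ge0//.
  by move: fp => /[!inE] /andP[_ /[!inE]].
move: f0 (Lnorm_ge0 mu p (EFin \o f)).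
case: ('N[mu]_p[EFin \o f])%E => // r r0 /=; rewrite lee_fin => r_ge0 _.
rewrite ger0_norm ?invr_ge0// -EFinM mulVf//.
by apply/eqP => re; apply: r0; rewrite re.
Qed.

End Lfun.

Lemma L2norm_normalize (R : realType) (d : nat) (W : set 'rV[R]_d)
    (f : 'rV[R]_d -> R) : L2 W f -> L2norm W f <> 0%E ->
  L2norm W (fun x => f x / fine (L2norm W f)) = 1%E.
Proof.
move=> fL2 f0.
rewrite -[RHS](@Lnorm_normalize _ _ _ (lebesgue_rV d) 2%:E (f \_ W))//;
  last by rewrite lee_fin ler1n.
congr ('N[_]__[_])%E; apply/funext => x /=; rewrite !patchE.
by case: ifPn => _; rewrite ?scaler0// mulrC.
Qed.

(** On [W], [v] is the value at time [t] of a curve in L^2, and [L2 W] sees only the extension by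
    zero. *)
Lemma heat_operator_L2 (R : realType) (d : nat) (bc : boundary_condition R d)
    (W : set 'rV[R]_d) (t : R) (u v : 'rV[R]_d -> R) :
  0 <= t -> heat_operator bc W t u v -> L2 W v.
Proof.
move=> t0 [w [wL2 [_ wt] _ _]]; rewrite /L2/=.
rewrite (_ : v \_ W = w t \_ W); first exact: wL2.
by apply/funext => x; rewrite !patchE; case: ifPn => // xW; rewrite wt.
Qed.

Lemma orthogonality_step_L2 (R : realType) (d k : nat) (W : set 'rV[R]_d)
    (v a : 'I_k -> 'rV[R]_d -> R) (i : 'I_k) :
  (forall j, L2 W (v j)) -> (forall j x, W x -> a j x = Num.max (v j x) 0) ->
  L2 W (orthogonality_step a i).
Proof.
move=> vL2 av.
(* Nothing is known of [a] outside [W]; cutting [v] off first yields a family measurable and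
   nonnegative on the whole space. *)
pose b j x := Num.max ((v j \_ W) x) 0.
have b0 j x : 0 <= b j x by rewrite le_max lexx orbT.
have mb j : measurable_fun setT (b j).
  apply: measurable_maxr => //.
  by move: (vL2 j); rewrite /L2/= inE => /andP[/[!inE]].
have stepE : orthogonality_step a i \_ W = orthogonality_step b i.
  apply/funext => x; rewrite patchE.
  case: ifPn => [/set_mem Wx|Wx].
    by apply: eq_orthogonality_step => j; rewrite av// /b patchE mem_set.
  (* Outside [W], [b i] is 0, which is not above a nonnegative maximum, so the step returns 0 as the
     extension does. *)
  rewrite /orthogonality_step ifF// {2}/b patchE (negbTE Wx) maxxx.
  by rewrite ltNge max_other_ge0.
rewrite /L2/= stepE; apply: (@Lfun_le _ _ _ _ _ _ (v i \_ W)) => //.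
- exact: vL2.
- exact: measurable_orthogonality_step.
move=> x; rewrite ger0_norm ?orthogonality_step_ge0//.
(* The step is at most [b i], the positive part of the cut-off [v i], hence at most its absolute
   value. *)
apply: (le_trans (orthogonality_step_le b i x (b0 i x))).
by rewrite ge_max ler_norm normr_ge0.
Qed.

Theorem theorem3p2 (R : realType) (d : nat) (bc : boundary_condition R d)
    (W : set 'rV[R]_d) (hW : admissible_domain bc W)
    (k : nat) (hk : (0 < k)%N) (tau : R) (htau : 0 < tau)
    (u ut ub uh : nat -> 'I_k -> 'rV[R]_d -> R)
    (hu0 : forall i, H10 W (u 0%N i))
    (hut : forall n i, heat_operator bc W tau (u n i) (ut n.+1 i))
    (hub : forall n i x, W x -> ub n.+1 i x = Num.max (ut n.+1 i x) 0)
    (huh : forall n i x, W x -> uh n.+1 i x = orthogonality_step (ub n.+1) i x)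
    (hu : forall n i x, W x ->
       u n.+1 i x = uh n.+1 i x / fine (L2norm W (uh n.+1 i)))
    (n : nat)
    (hwd : forall m i, (m <= n)%N -> L2norm W (uh m.+1 i) <> 0%E) :
  forall i : 'I_k,
    [/\ forall x, W x -> 0 <= u n.+1 i x,
        L2norm W (u n.+1 i) = 1%E &
        forall j : 'I_k, j != i ->
          forall x, W x -> u n.+1 i x * u n.+1 j x = 0].
Proof.
move=> i.
have ub_ge0 j x : W x -> 0 <= ub n.+1 j x.
  by move=> Wx; rewrite hub// le_max lexx orbT.
(* [uh] is prescribed on [W] only, so the identity is stated between extensions by zero. *)
have uh_step j : uh n.+1 j \_ W = orthogonality_step (ub n.+1) j \_ W.
  by apply/eq_restrictP => x /set_mem Wx; exact: huh.
split=> [x Wx||j ji x Wx].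
- rewrite hu// huh// divr_ge0//; last exact/fine_ge0/Lnorm_ge0.
  by apply: orthogonality_step_ge0 => j; exact: ub_ge0.
- rewrite -(@L2norm_normalize _ _ W (uh n.+1 i)); last exact: hwd.
    rewrite /L2norm; congr ('N[_]__[EFin \o _])%E.
    by apply/eq_restrictP => x /set_mem Wx; exact: hu.
  rewrite /L2/= uh_step.
  apply: (@orthogonality_step_L2 _ _ _ _ (ut n.+1)) => [j|j x]; last exact: hub.
  exact: heat_operator_L2 (ltW htau) (hut n j).
(* Regrouping isolates the product of the two unnormalized components, which vanishes. *)
- by rewrite !hu// !huh// mulrACA orthogonality_step_mul0 ?mul0r.
Qed.
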